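(* Let $(\Lambda,d)$ be a $k$-graph and let $A$ be an abelian group. For $\phi\in Z^2(\Lambda,A)$ define $c_\phi:\Lambda^{*2}\to A$ by $c_\phi(\mu,\nu):=S_\phi(\overline{\mu}\,\overline{\nu})$. Then $c_\phi\in\underline{Z}^2(\Lambda,A)$, and $\phi\mapsto c_\phi$ is a homomorphism from $Z^2(\Lambda,A)$ to $\underline{Z}^2(\Lambda,A)$ satisfying: (1) for composable edges $f,g$, $c_\phi(f,g)=\phi(fg)$ if $d(f)=e_i$ and $d(g)=e_j$ with $i>j$, and $c_\phi(f,g)=0$ if $d(f)=e_i$ and $d(g)=e_j$ with $i\le j$; and (2) $c_\phi(\mu,\nu)=0$ whenever $\overline{\mu}\,\overline{\nu}=\overline{\mu\nu}$; in particular $c_\phi(r(\lambda),\lambda)=c_\phi(\lambda,s(\lambda))=0$ for all $\lambda\in\Lambda$. Moreover, if $\phi\in B^2(\Lambda,A)$, then $c_\phi\in\underline{B}^2(\Lambda,A)$; hence $[\phi]\mapsto[c_\phi]$ defines a homomorphism $\psi:H^2(\Lambda,A)\to\underline{H}^2(\Lambda,A)$.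
   Context: $k$-graphs. For a nonnegative integer $k$, a $k$-graph is a nonempty countable small category $\Lambda$ with a functor $d:\Lambda\to\mathbb{N}^k$ (the degree; $0\in\mathbb{N}$) with the factorisation property: whenever $d(\lambda)=m+n$ with $m,n\in\mathbb N^k$ there are unique $\mu,\nu\in\Lambda$ with $d(\mu)=m$, $d(\nu)=n$, $\lambda=\mu\nu$. Write $\Lambda^n=d^{-1}(n)$. The set $\Lambda^0$ is identified with the set of objects (identity morphisms), and $r,s:\Lambda\to\Lambda^0$ are codomain and domain; $\mu\nu$ is defined iff $s(\mu)=r(\nu)$. Let $e_1,\dots,e_k$ be the generators of $\mathbb{N}^k$, $|n|=\sum_i n_i$ and $|\lambda|=|d(\lambda)|$. An edge is an element of some $\Lambda^{e_i}$. Cubical cohomology. Let $Q_r(\Lambda)=\{\lambda\in\Lambda: d(\lambda)\le(1,\dots,1),\ |\lambda|=r\}$ (empty for $r>k$). If $\lambda\in Q_r(\Lambda)$ has $d(\lambda)=e_{i_1}+\cdots+e_{i_r}$ with $i_1<\cdots<i_r$, then for $1\le j\le r$, $F_j^0(\lambda),F_j^1(\lambda)$ are the unique elements of $\Lambda^{d(\lambda)-e_{i_j}}$ such that $\lambda=F_j^0(\lambda)\beta=\alpha F_j^1(\lambda)$ for some $\alpha,\beta\in\Lambda^{e_{i_j}}$. $C^r(\Lambda,A)$ is the group of all functions $Q_r(\Lambda)\to A$, and $(\delta^r f)(\lambda)=\sum_{i=1}^{r+1}\sum_{\ell=0}^1(-1)^{i+\ell}f(F_i^\ell(\lambda))$ for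 $\lambda\in Q_{r+1}(\Lambda)$. Put $Z^r=\ker\delta^r$, $B^r=\operatorname{Im}\delta^{r-1}$, $H^r=Z^r/B^r$. Categorical cohomology. For $r\ge1$, $\Lambda^{*r}$ is the set of composable $r$-tuples $(\lambda_1,\dots,\lambda_r)$ ($s(\lambda_i)=r(\lambda_{i+1})$). $\underline{C}^r(\Lambda,A)$ is the group of functions $f:\Lambda^{*r}\to A$ with $f(\lambda_1,\dots,\lambda_r)=0$ whenever some $\lambda_i\in\Lambda^0$. For $r\ge1$, $(\underline{\delta}^rf)(\lambda_0,\dots,\lambda_r)=f(\lambda_1,\dots,\lambda_r)+\sum_{i=1}^r(-1)^if(\lambda_0,\dots,\lambda_{i-2},\lambda_{i-1}\lambda_i,\lambda_{i+1},\dots,\lambda_r)+(-1)^{r+1}f(\lambda_0,\dots,\lambda_{r-1})$. Put $\underline{Z}^2=\ker\underline{\delta}^2$, $\underline{B}^2=\operatorname{Im}\underline{\delta}^{1}$, $\underline{H}^2=\underline{Z}^2/\underline{B}^2$. Shuffle function. Let $E_\Lambda$ be the path category of the directed graph with vertex set $\Lambda^0$, edge set $Q_1(\Lambda)=\bigcup_i\Lambda^{e_i}$, and $r,s$ inherited from $\Lambda$: its elements are the vertices and the formal strings $u=u_1\cdots u_n$ of edges with $s(u_i)=r(u_{i+1})$. For an edge $e\in\Lambda^{e_i}$ put $C(e)=i$. Let $\pi:E_\Lambda\to\Lambda$ be the functor that composes the edges of a string in $\Lambda$ (identity on vertices). For $\lambda\in\Lambda$, $\overline{\lambda}\in E_\Lambda$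 is the unique path $\overline{\lambda}_1\cdots\overline{\lambda}_{|\lambda|}$ with $\pi(\overline{\lambda})=\lambda$ and $C(\overline{\lambda}_i)\le C(\overline{\lambda}_{i+1})$ for all $i$. An allowable transition is a pair $(u,w)\in E_\Lambda\times E_\Lambda$ with $\pi(u)=\pi(w)$ for which there is $i$ with $u_j=w_j$ for $j\notin\{i,i+1\}$ and $C(w_{i+1})=C(u_i)<C(u_{i+1})=C(w_i)$; for $\phi\in Z^2(\Lambda,A)$ put $\tilde\phi(u,w)=\phi(\pi(u_iu_{i+1}))$. For each $w\in E_\Lambda$ there is a finite sequence $w=w^0,w^1,\dots,w^n=\overline{\pi(w)}$ with every $(w^j,w^{j-1})$ an allowable transition; $S_\phi(w):=\sum_{j=1}^n\tilde\phi(w^j,w^{j-1})\in A$, which does not depend on the chosen sequence. *)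

(* Defs.v *)
From HB Require Import structures.
From mathcomp Require Import all_boot all_order all_algebra.
From mathcomp Require Import boolp functions.
Set Implicit Arguments.
Unset Strict Implicit.
Unset Printing Implicit Defensive.
Import GRing.Theory.
Local Open Scope ring_scope.

Section Degrees.
Context {k : nat}.
Implicit Types (m n : {ffun 'I_k -> nat}).

Definition gen (i : 'I_k) : {ffun 'I_k -> nat} := [ffun j => (i == j) : nat].

Definition tdeg n : nat := (\sum_i n i)%N.

Definition subdeg m n : {ffun 'I_k -> nat} := [ffun i => (m i - n i)%N].

Lemma subdegK n i : (0 < n i)%N -> n = subdeg n (gen i) + gen i.
Proof.
move=> ni; apply/ffunP=> j; rewrite !ffunE.
by case: eqP => [<-|_] /=; rewrite ?subn0 ?addr0 //; apply/esym/subnK.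
Qed.

Lemma subdegKC n i : (0 < n i)%N -> n = gen i + subdeg n (gen i).
Proof. by move=> ni; rewrite addrC; apply: subdegK. Qed.

Lemma tdegD m n : tdeg (m + n) = (tdeg m + tdeg n)%N.
Proof. by rewrite /tdeg -big_split; apply: eq_bigr => i _; rewrite ffunE. Qed.

Lemma tdeg_gen i : tdeg (gen i) = 1%N.
Proof.
rewrite /tdeg (bigD1 i) //= ffunE eqxx big1 ?addn0 // => j ji.
by rewrite ffunE eq_sym (negPf ji).
Qed.

Lemma tdeg_eq0 n : (tdeg n == 0%N) = (n == 0).
Proof.
rewrite sum_nat_eq0; apply/forallP/eqP => [n0|-> i]; last by rewrite ffunE.
by apply/ffunP => i; rewrite ffunE; apply/eqP/n0.
Qed.

Lemma tdeg0 : tdeg 0 = 0%N.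
Proof. by apply/eqP; rewrite tdeg_eq0. Qed.

Lemma gen_inj : injective gen.
Proof.
by move=> i j /ffunP/(_ i); rewrite !ffunE eqxx; case: eqP => [->|].
Qed.

End Degrees.

(* Composition is a total function for convenience: [mcomp mu nu] stands for
   mu nu when [dom mu = cod nu], and is unconstrained otherwise. *)
Record kgraph (k : nat) := KGraph {
  obj : countType;
  mor :> countType;
  cod : mor -> obj;
  dom : mor -> obj;
  idm : obj -> mor;
  mcomp : mor -> mor -> mor;
  deg : mor -> {ffun 'I_k -> nat};
  _ : inhabited obj;
  cod_id : forall v, cod (idm v) = v;
  dom_id : forall v, dom (idm v) = v;
  cod_comp : forall mu nu, dom mu = cod nu -> cod (mcomp mu nu) = cod mu;
  dom_comp : forall mu nu, dom mu = cod nu -> dom (mcomp mu nu) = dom nu;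
  comp_idl : forall la, mcomp (idm (cod la)) la = la;
  comp_idr : forall la, mcomp la (idm (dom la)) = la;
  compA : forall la mu nu, dom la = cod mu -> dom mu = cod nu ->
    mcomp la (mcomp mu nu) = mcomp (mcomp la mu) nu;
  deg_id : forall v, deg (idm v) = 0;
  deg_comp : forall mu nu, dom mu = cod nu ->
    deg (mcomp mu nu) = deg mu + deg nu;
  factorisation : forall la m n, deg la = m + n ->
    exists! p : mor * mor,
      [/\ dom p.1 = cod p.2, deg p.1 = m, deg p.2 = n & mcomp p.1 p.2 = la]
}.

Arguments obj {k} _.
Arguments mor {k} _.
Arguments cod {k _} _.
Arguments dom {k _} _.
Arguments idm {k} _ _.
Arguments mcomp {k _} _ _.
Arguments deg {k _} _.

Section KGraph.
Variables (k : nat) (L : kgraph k).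
Implicit Types (la mu nu : L) (m n : {ffun 'I_k -> nat}).

Definition factor la m n (h : deg la = m + n) : L * L :=
  sval (cid (factorisation h)).

Lemma factorP la m n (h : deg la = m + n) :
  let p := factor h in
  [/\ dom p.1 = cod p.2, deg p.1 = m, deg p.2 = n & mcomp p.1 p.2 = la].
Proof. by rewrite /= /factor; case: cid => p []. Qed.

Lemma factor_unique mu nu mu' nu' :
  dom mu = cod nu -> dom mu' = cod nu' -> mcomp mu nu = mcomp mu' nu' ->
  deg mu = deg mu' -> deg nu = deg nu' -> mu = mu' /\ nu = nu'.
Proof.
move=> c c' e dm dn.
have [p [_ up]] := factorisation (deg_comp c).
have E1 : p = (mu, nu) by apply: up.
have E2 : p = (mu', nu') by apply: up; split.
by move: E1; rewrite E2 => -[-> ->].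
Qed.

Lemma deg0_id la : deg la = 0 -> la = idm L (cod la).
Proof.
move=> d0.
have h1 : dom (idm L (cod la)) = cod la by rewrite dom_id.
have h2 : dom la = cod (idm L (dom la)) by rewrite cod_id.
have := @factor_unique la (idm L (dom la)) (idm L (cod la)) la h2 h1.
by rewrite comp_idl comp_idr !deg_id => /(_ erefl d0 (esym d0))[].
Qed.

Definition is_cube (r : nat) : pred L :=
  fun la => [forall i, (deg la i <= 1)%N] && (tdeg (deg la) == r).

Definition cube (r : nat) := {la : L | is_cube r la}.

(* The colours i_1 < ... < i_r with d(la) = e_{i_1} + ... + e_{i_r}. *)
Definition colours la : seq 'I_k := [seq i <- enum 'I_k | (0 < deg la i)%N].

Lemma size_colours r (q : cube r) : size (colours (val q)) == r.
Proof.
case: q => la /= /andP[/forallP d1 /eqP <-]; rewrite /colours size_filter.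
rewrite -sum1_count big_enum_cond /tdeg big_mkcond; apply/eqP/eq_bigr => i _ /=.
by have := d1 i; case: (deg la i) => [|[]].
Qed.

Definition colour_at r (q : cube r) (j : 'I_r) : 'I_k :=
  tnth (Tuple (size_colours q)) j.

Lemma colour_at_gt0 r (q : cube r) j : (0 < deg (val q) (colour_at q j))%N.
Proof.
have := mem_tnth j (Tuple (size_colours q)).
by rewrite [in X in X -> _]/= memtE /= mem_filter => /andP[].
Qed.

(* [face_mor false q j] is F_j^0 and [face_mor true q j] is F_j^1, with [j]
   counted from 0. *)
Definition face_mor (l : bool) r (q : cube r) (j : 'I_r) : L :=
  if l then (factor (subdegKC (colour_at_gt0 q j))).2
  else (factor (subdegK (colour_at_gt0 q j))).1.

Lemma deg_face l r (q : cube r) j :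
  deg (face_mor l q j) = subdeg (deg (val q)) (gen (colour_at q j)).
Proof.
by case: l; rewrite /face_mor; set h := (X in factor X); case: (factorP h).
Qed.

Lemma face_cube l r (q : cube r.+1) j : is_cube r (face_mor l q j).
Proof.
rewrite /is_cube deg_face; have := colour_at_gt0 q j.
set i := colour_at q j => i0.
case/andP: (valP q) => /forallP d1 /eqP dr; apply/andP; split.
  by apply/forallP => x; rewrite ffunE; apply: leq_trans (d1 x); apply: leq_subr.
move: dr; rewrite {1}(subdegK i0) tdegD tdeg_gen addn1 => -[->].
by rewrite eqxx.
Qed.

Definition face l r (q : cube r.+1) (j : 'I_r.+1) : cube r :=
  exist _ (face_mor l q j) (face_cube l q j).

Definition composable : rel L := fun mu nu => dom mu == cod nu.

(* Composable [r]-tuples; only used for [r >= 1]. *)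
Definition nerve (r : nat) :=
  {s : seq L | (size s == r) && sorted composable s}.

(* [merge_at i] composes the entries in positions [i] and [i.+1]. *)
Fixpoint merge_at (i : nat) (s : seq L) : seq L :=
  match i, s with
  | 0%N, x :: y :: s' => mcomp x y :: s'
  | i'.+1, x :: s' => x :: merge_at i' s'
  | _, _ => s
  end.

Lemma path_merge i x s :
  (i.+1 < size s)%N -> path composable x s -> path composable x (merge_at i s).
Proof.
elim: i x s => [|i IH] x [|y [|z s]] //=.
  move=> _ /and3P[/eqP xy /eqP yz p]; apply/andP; split.
    by rewrite /composable cod_comp // xy.
  case: s p => //= t s /andP[/eqP zt pt].
  by apply/andP; split=> //; rewrite /composable dom_comp ?zt.
by move=> si /andP[-> p] /=; apply: (IH y (z :: s)).
Qed.

Lemma size_merge i s : (i.+1 < size s)%N -> size (merge_at i s) = (size s).-1.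
Proof.
elim: i s => [|i IH] [|x [|y s]] //= si.
by rewrite IH.
Qed.

Lemma sorted_merge i s :
  (i.+1 < size s)%N -> sorted composable s -> sorted composable (merge_at i s).
Proof.
case: i s => [|i] [|x [|y s]] // si p.
  case/andP: p => /eqP xy; case: s {si} => //= z s /andP[/eqP yz pz].
  by apply/andP; split=> //; rewrite /composable dom_comp ?yz.
exact: (@path_merge i x (y :: s)).
Qed.

Lemma nmerge_subproof r (s : nerve r.+1) (i : 'I_r) :
  (size (merge_at i (val s)) == r) && sorted composable (merge_at i (val s)).
Proof.
case: s => s /= /andP[/eqP ss p].
have h : (i.+1 < size s)%N by rewrite ss ltnS.
by rewrite size_merge // ss eqxx sorted_merge.
Qed.

Lemma nbehead_subproof r (s : nerve r.+1) :
  (size (behead (val s)) == r) && sorted composable (behead (val s)).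
Proof.
case: s => -[|x s] //= /andP[/eqP [->] p].
by rewrite eqxx (path_sorted p).
Qed.

Lemma ntake_subproof r (s : nerve r.+1) :
  (size (take r (val s)) == r) && sorted composable (take r (val s)).
Proof.
case: s => s /= /andP[/eqP ss p].
by rewrite size_takel ?ss ?leqnSn // eqxx take_sorted.
Qed.

Definition nmerge r (s : nerve r.+1) (i : 'I_r) : nerve r :=
  exist _ (merge_at i (val s)) (nmerge_subproof s i).
Definition nbehead r (s : nerve r.+1) : nerve r :=
  exist _ (behead (val s)) (nbehead_subproof s).
Definition ntake r (s : nerve r.+1) : nerve r :=
  exist _ (take r (val s)) (ntake_subproof s).

Lemma npair_subproof mu nu (h : dom mu = cod nu) :
  (size [:: mu; nu] == 2%N) && sorted composable [:: mu; nu].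
Proof. by rewrite /= andbT; apply/eqP. Qed.

Definition npair mu nu (h : dom mu = cod nu) : nerve 2 :=
  exist _ [:: mu; nu] (npair_subproof h).

Definition is_edge : pred L := fun la => [exists i, deg la == gen i].

Definition edge := {la : L | is_edge la}.

Lemma edge_colourP (e : edge) : exists i, deg (val e) == gen i.
Proof. exact/existsP/(valP e). Qed.

Definition colour (e : edge) : 'I_k := xchoose (edge_colourP e).

Lemma deg_edge (e : edge) : deg (val e) = gen (colour e).
Proof. exact/eqP/(xchooseP (edge_colourP e)). Qed.

Lemma colour_eq (e : edge) i : deg (val e) = gen i -> colour e = i.
Proof. by rewrite deg_edge => /gen_inj. Qed.

Fixpoint is_epath (v : obj L) (es : seq edge) : bool :=
  if es is e :: es' then (cod (val e) == v) && is_epath (dom (val e)) es'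
  else true.

(* Elements of E_Lambda. The range is recorded so that vertices are included:
   [(v, [::])] is the vertex [v]. *)
Definition epath := {p : obj L * seq edge | is_epath p.1 p.2}.

Definition erange (w : epath) : obj L := (val w).1.
Definition edges (w : epath) : seq edge := (val w).2.

Fixpoint seq_source (v : obj L) (es : seq edge) : obj L :=
  if es is e :: es' then seq_source (dom (val e)) es' else v.

Definition esource (w : epath) : obj L := seq_source (erange w) (edges w).

Fixpoint seq_pi (v : obj L) (es : seq edge) : L :=
  if es is e :: es' then mcomp (val e) (seq_pi (dom (val e)) es')
  else idm L v.

Definition pi (w : epath) : L := seq_pi (erange w) (edges w).

Lemma is_epath_cat v es es' :
  is_epath v (es ++ es') = is_epath v es && is_epath (seq_source v es) es'.
Proof. by elim: es v => //= e es IH v; rewrite IH andbA. Qed.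

Lemma ecat_subproof (u w : epath) (h : esource u = erange w) :
  is_epath (erange u) (edges u ++ edges w).
Proof.
rewrite is_epath_cat; apply/andP; split; first exact: (valP u).
by move: h; rewrite /esource => ->; apply: (valP w).
Qed.

Definition ecat (u w : epath) (h : esource u = erange w) : epath :=
  exist _ (erange u, edges u ++ edges w) (ecat_subproof h).

Lemma cod_seq_pi v es : is_epath v es -> cod (seq_pi v es) = v.
Proof.
elim: es v => [|e es IH] v /=; first by rewrite cod_id.
by case/andP=> /eqP <- p; rewrite cod_comp ?IH.
Qed.

Lemma dom_seq_pi v es : is_epath v es -> dom (seq_pi v es) = seq_source v es.
Proof.
elim: es v => [|e es IH] v /=; first by rewrite dom_id.
by case/andP=> /eqP _ p; rewrite dom_comp ?cod_seq_pi ?IH.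
Qed.

Lemma cod_pi w : cod (pi w) = erange w.
Proof. exact/cod_seq_pi/(valP w). Qed.

Lemma dom_pi w : dom (pi w) = esource w.
Proof. exact/dom_seq_pi/(valP w). Qed.

Definition increasing (es : seq edge) : bool :=
  sorted (fun e f => colour e <= colour f)%N es.

Lemma deg_seq_pi v es : is_epath v es ->
  deg (seq_pi v es) = \sum_(e <- es) gen (colour e).
Proof.
elim: es v => [|e es IH] v /=; first by rewrite deg_id big_nil.
case/andP=> _ p; rewrite deg_comp ?cod_seq_pi //.
by rewrite (IH _ p) deg_edge big_cons.
Qed.

Lemma sum_gen_gt0 es (i : 'I_k) :
  (0 < (\sum_(e <- es) gen (colour e))%R i)%N = (i \in map colour es).
Proof.
elim: es => [|e es IH]; first by rewrite big_nil ffunE.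
by rewrite big_cons ffunE inE addn_gt0 IH ffunE eq_sym; case: eqP.
Qed.

Lemma colour_le_trans :
  transitive (fun e f : edge => (colour e <= colour f)%N).
Proof. by move=> e f g; apply: leq_trans. Qed.

Lemma is_edge_gen la i : deg la = gen i -> is_edge la.
Proof. by move=> d; apply/existsP; exists i; rewrite d. Qed.

Definition mk_edge la i (h : deg la = gen i) : edge :=
  exist _ la (is_edge_gen h).

Lemma normal_form_seq la :
  exists2 es, is_epath (cod la) es & (seq_pi (cod la) es == la) && increasing es.
Proof.
elim: {la}(tdeg (deg la)) {-2}la (erefl (tdeg (deg la))) => [|n IH] la.
  move/eqP; rewrite tdeg_eq0 => /eqP d0; exists [::] => //=.
  by rewrite -deg0_id // eqxx.
move=> dn.
have [i0 di0] : exists i, (0 < deg la i)%N.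
  apply/existsP; apply: contra_eqT dn; rewrite negb_exists => /forallP d0.
  by rewrite /tdeg big1 // => i _; apply/eqP; rewrite -leqn0 leqNgt d0.
case: (@arg_minnP _ i0 (fun i => 0 < deg la i)%N (fun i : 'I_k => i : nat) di0) => i di mini.
have [] := factorP (subdegKC di); set p := factor _ => c d1 d2 cla.
have [|es pes /andP[/eqP ees ses]] := IH p.2.
  by move: dn; rewrite d2 {1}(subdegKC di) tdegD tdeg_gen => -[].
have ce : colour (mk_edge d1) = i by apply: colour_eq.
exists (mk_edge d1 :: es) => /=.
  by rewrite c pes andbT -cla cod_comp.
rewrite c ees cla eqxx /= /increasing /= (path_sortedE colour_le_trans).
apply/andP; split=> //; apply/allP => f fes; rewrite ce; apply: mini.
have : (0 < deg p.2 (colour f))%N.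
  by rewrite -ees deg_seq_pi // sum_gen_gt0 map_f.
by rewrite d2 ffunE => /leq_trans; apply; apply: leq_subr.
Qed.

Lemma increasing_unique v w es fs :
  is_epath v es -> is_epath w fs -> seq_pi v es = seq_pi w fs ->
  increasing es -> increasing fs -> es = fs.
Proof.
elim: es fs v w => [|e es IH] [|f fs] v w pe pf eef se sf //.
- have := congr1 (fun la => tdeg (deg la)) eef.
  by rewrite !deg_seq_pi // big_nil big_cons tdegD tdeg_gen tdeg0.
- have := congr1 (fun la => tdeg (deg la)) eef.
  by rewrite !deg_seq_pi // big_nil big_cons tdegD tdeg_gen tdeg0.
have dd : deg (seq_pi v (e :: es)) = deg (seq_pi w (f :: fs)) by rewrite eef.
rewrite !deg_seq_pi // in dd.
have mem i : (i \in map colour (e :: es)) = (i \in map colour (f :: fs)).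
  by rewrite -!sum_gen_gt0 dd.
have le_e : forall x, x \in e :: es -> (colour e <= colour x)%N.
  move=> x; rewrite inE => /predU1P[->//|xs].
  move: se; rewrite /increasing /= (path_sortedE colour_le_trans).
  by case/andP=> /allP/(_ x xs).
have le_f : forall x, x \in f :: fs -> (colour f <= colour x)%N.
  move=> x; rewrite inE => /predU1P[->//|xs].
  move: sf; rewrite /increasing /= (path_sortedE colour_le_trans).
  by case/andP=> /allP/(_ x xs).
have cef : colour e = colour f.
  apply/val_inj/eqP; rewrite eqn_leq; apply/andP; split.
    have : colour f \in map colour (e :: es) by rewrite mem map_f ?mem_head.
    by case/mapP => x /le_e h ->.
  have : colour e \in map colour (f :: fs) by rewrite -mem map_f ?mem_head.
  by case/mapP => x /le_f h ->.
case/andP: (pe) => /eqP _ pe'; case/andP: (pf) => /eqP _ pf'.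
have [|||||hef hpi] := @factor_unique (val e) (seq_pi (dom (val e)) es)
   (val f) (seq_pi (dom (val f)) fs).
- by rewrite cod_seq_pi.
- by rewrite cod_seq_pi.
- exact: eef.
- by rewrite !deg_edge cef.
- move: dd; rewrite !big_cons cef => /ffunP dd.
  rewrite !deg_seq_pi //; apply/ffunP => i.
  by have := dd i; rewrite !ffunE => /addnI.
rewrite (val_inj hef); congr cons.
apply: (IH _ _ _ pe' pf' hpi).
  exact: path_sorted se.
exact: path_sorted sf.
Qed.

Lemma normal_form_ex la :
  exists w : epath, (pi w == la) && increasing (edges w).
Proof.
have [es pes h] := normal_form_seq la.
by exists (exist _ (cod la, es) pes).
Qed.

(* The path \overline{la} of E_Lambda. *)
Definition normal_form la : epath := xchoose (normal_form_ex la).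

Lemma pi_normal_form la : pi (normal_form la) = la.
Proof. by case/andP: (xchooseP (normal_form_ex la)) => /eqP. Qed.

Lemma increasing_normal_form la : increasing (edges (normal_form la)).
Proof. by case/andP: (xchooseP (normal_form_ex la)). Qed.

Lemma normal_form_unique la (w : epath) :
  pi w = la -> increasing (edges w) -> w = normal_form la.
Proof.
move=> pw sw.
have e := increasing_unique (valP w) (valP (normal_form la))
   (etrans pw (esym (pi_normal_form la))) sw (increasing_normal_form la).
apply: val_inj; rewrite [LHS]surjective_pairing [RHS]surjective_pairing e.
congr pair.
by rewrite -[(val w).1]/(erange w) -[RHS]/(erange _) -!cod_pi pw pi_normal_form.
Qed.

Lemma normal_form_composable mu nu : dom mu = cod nu ->
  esource (normal_form mu) = erange (normal_form nu).
Proof. by rewrite -dom_pi -cod_pi !pi_normal_form. Qed.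

(* [i] is counted from 0. *)
Definition allowable_at (i : nat) (u w : epath) : bool :=
  [&& pi u == pi w,
      take i (edges u) == take i (edges w),
      drop i.+2 (edges u) == drop i.+2 (edges w) &
      match drop i (edges u), drop i (edges w) with
      | ui :: ui1 :: _, wi :: wi1 :: _ =>
          [&& colour wi1 == colour ui, (colour ui < colour ui1)%N
            & colour ui1 == colour wi]
      | _, _ => false
      end].

Definition allowable (u w : epath) : bool :=
  [exists i : 'I_(size (edges u)), allowable_at i u w].

Lemma edges_square (e f : edge) : dom (val e) = cod (val f) ->
  colour e != colour f -> is_cube 2 (mcomp (val e) (val f)).
Proof.
move=> c ne; rewrite /is_cube deg_comp // !deg_edge tdegD !tdeg_gen eqxx andbT.
apply/forallP => i; rewrite !ffunE.
case: (eqVneq (colour e) i) => [<-|_]; last by case: eqP.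
by rewrite eq_sym (negPf ne).
Qed.

(* [ws] is w^1, ..., w^n, starting from w^0 = w. *)
Definition reduces (w : epath) (ws : seq epath) : bool :=
  path (fun w u => allowable u w) w ws && (last w ws == normal_form (pi w)).

Lemma swap_ex (e f : edge) : dom (val e) = cod (val f) ->
  exists p : edge * edge,
   [/\ dom (val p.1) = cod (val p.2), colour p.1 = colour f,
       colour p.2 = colour e & mcomp (val p.1) (val p.2) = mcomp (val e) (val f)].
Proof.
move=> c.
have h : deg (mcomp (val e) (val f)) = gen (colour f) + gen (colour e).
  by rewrite deg_comp // !deg_edge addrC.
have [c' d1 d2 cc] := factorP h.
exists (mk_edge d1, mk_edge d2).
by split=> //; apply: colour_eq.
Qed.

Inductive swap_red (v : obj L) : seq edge -> seq edge -> Prop :=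
| SwapRefl es : swap_red v es es
| SwapStep es1 e f p q es2 fs :
    is_epath v (es1 ++ p :: q :: es2) ->
    seq_pi v (es1 ++ p :: q :: es2) = seq_pi v (es1 ++ e :: f :: es2) ->
    colour p = colour f -> colour q = colour e -> (colour f < colour e)%N ->
    swap_red v (es1 ++ p :: q :: es2) fs -> swap_red v (es1 ++ e :: f :: es2) fs.

Lemma swap_red_cons v e es fs : cod (val e) = v ->
  swap_red (dom (val e)) es fs -> swap_red v (e :: es) (e :: fs).
Proof.
move=> cv; elim=> [gs|es1 a b p q es2 gs pp ee cp cq ab _ IH]; first by left.
apply: (@SwapStep v (e :: es1) a b p q es2) => //=; first by rewrite cv eqxx.
by rewrite ee.
Qed.

Lemma swap_red_trans v es fs gs :
  swap_red v es fs -> swap_red v fs gs -> swap_red v es gs.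
Proof.
elim=> // es1 a b p q es2 hs pp ee cp cq ab _ IH /IH.
exact: SwapStep.
Qed.

Lemma swap_red_insert v e es : is_epath v (e :: es) -> increasing es ->
  exists fs, [/\ swap_red v (e :: es) fs, is_epath v fs, increasing fs
    & perm_eq (map colour fs) (map colour (e :: es))].
Proof.
elim: es v e => [|f es IH] v e pe se.
  by exists [:: e]; split=> //; left.
case: (leqP (colour e) (colour f)) => [ef|fe].
  by exists [:: e, f & es]; split=> //; [left | rewrite /increasing /= ef].
case/and3P: (pe) => /eqP cv /eqP cef pes.
have [[p q] /= [c cp cq cc]] := swap_ex (esym cef).
have dq : dom (val q) = dom (val f).
  by rewrite -(dom_comp c) cc dom_comp.
have cpv : cod (val p) = v by rewrite -(cod_comp c) cc cod_comp.
have [||fs [r1 r2 r3 r4]] := IH (dom (val p)) q.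
- by rewrite /= c eqxx dq.
- exact: path_sorted se.
exists (p :: fs); split.
- apply: (@SwapStep v [::] e f p q es) => //.
  + by rewrite /= cpv c dq !eqxx.
  + by rewrite /= !compA ?cod_seq_pi ?dq ?cc.
  + exact: swap_red_cons.
- by rewrite /= cpv eqxx.
- rewrite /increasing /= (path_sortedE colour_le_trans).
  apply/andP; split; last exact: r3.
  apply/allP => x /(map_f colour); rewrite (perm_mem r4) inE cp cq.
  case/predU1P => [->|/mapP[y ys ->]]; first exact: ltnW.
  move: se; rewrite /increasing /= (path_sortedE colour_le_trans).
  by case/andP => /allP/(_ y ys).
- rewrite /= cp (perm_trans (y := colour f :: map colour (q :: es))) //.
    by rewrite perm_cons.
  by rewrite /= cq -[_ :: _ :: _]/([:: _] ++ [:: _] ++ _) perm_catCA.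
Qed.

Lemma swap_red_sort v es : is_epath v es ->
  exists2 fs, swap_red v es fs & is_epath v fs && increasing fs.
Proof.
elim: es v => [|e es IH] v pe; first by exists [::] => //; left.
case/andP: (pe) => /eqP cv pes.
have [fs r /andP[pf sf]] := IH _ pes.
have [|gs [r' pg sg _]] := @swap_red_insert v e fs _ sf.
  by rewrite /= cv eqxx.
by exists gs; rewrite ?pg //; apply: swap_red_trans r'; apply: swap_red_cons.
Qed.

Lemma swap_red_reduces v es fs (pe : is_epath v es) (pf : is_epath v fs) :
  swap_red v es fs -> seq_pi v es = seq_pi v fs /\
  exists ws, path (fun w u => allowable u w) (exist _ (v, es) pe : epath) ws
    /\ last (exist _ (v, es) pe : epath) ws = exist _ (v, fs) pf.
Proof.
move=> r; elim: r pe pf => [gs|es1 e f p q es2 gs pp ee cp cq fe _ IH] pe pf.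
  by split=> //; exists [::]; split=> //; apply: val_inj.
have [ep [ws [pws lws]]] := IH pp pf; split; first by rewrite -ee.
exists ((exist _ (v, es1 ++ p :: q :: es2) pp : epath) :: ws); split => //=.
rewrite pws andbT; apply/existsP.
have si : (size es1 < size (es1 ++ p :: q :: es2))%N.
  by rewrite size_cat /= -addSnnS leq_addr.
exists (Ordinal si); rewrite /allowable_at /pi /erange /edges /= ee eqxx.
have drop2 x y (t : seq edge) : drop (size es1).+2 (es1 ++ [:: x, y & t]) = t.
  by rewrite -addn2 addnC -drop_drop drop_size_cat //= drop0.
by rewrite !take_size_cat // !drop2 !drop_size_cat //= cp cq fe !eqxx.
Qed.

Lemma reduces_ex w : exists ws, reduces w ws.
Proof.
case: w => -[v es] pe; have [fs r /andP[pf sf]] := swap_red_sort pe.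
have [epi [ws [pws lws]]] := swap_red_reduces pe pf r.
exists ws; rewrite /reduces pws lws /=; exact/eqP/normal_form_unique.
Qed.

Definition reduction w : seq epath := xchoose (reduces_ex w).

Lemma reductionP w : reduces w (reduction w).
Proof. exact: xchooseP (reduces_ex w). Qed.

Lemma allowable_at_cube i (u w : epath) e f es : allowable_at i u w ->
  drop i (edges u) = e :: f :: es -> is_cube 2 (mcomp (val e) (val f)).
Proof.
case/and4P=> _ _ _ h du; rewrite du in h.
case: (drop i (edges w)) h => // wi [|wi1 _] // /and3P[_ ef _].
apply: edges_square; last by rewrite neq_ltn ef.
have := valP u; rewrite -[(val u).2]/(edges u) -(cat_take_drop i (edges u)) du.
by rewrite is_epath_cat => /andP[_ /= /and3P[_ /eqP]].
Qed.

End KGraph.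

Section Cohomology.
Variables (k : nat) (L : kgraph k) (A : zmodType).

Definition cochain (r : nat) := cube L r -> A.
HB.instance Definition _ r := GRing.Zmodule.on (cochain r).

Definition delta r (f : cochain r) : cochain r.+1 := fun q =>
  \sum_(j < r.+1) \sum_(l : bool)
    f (face l q j) *~ ((-1) ^+ (j.+1 + l)).

Lemma deltaB r : {morph @delta r : f g / f - g}.
Proof.
move=> f g; apply/funext => q; rewrite -[RHS]/(delta f q - delta g q).
rewrite /delta -sumrB; apply: eq_bigr => j _; rewrite -sumrB.
by apply: eq_bigr => l _; rewrite -mulrzBl.
Qed.

Lemma delta0 r : delta (0 : cochain r) = 0.
Proof. by rewrite -[X in delta X](subrr 0) deltaB subrr. Qed.

Definition cocycle r : {pred cochain r} := fun f => delta f == 0.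

Lemma cocycle_closed r : zmod_closed (@cocycle r).
Proof.
split=> [|f g /eqP f0 /eqP g0]; last by rewrite unfold_in deltaB f0 g0 subrr.
by rewrite unfold_in delta0.
Qed.

HB.instance Definition _ r :=
  GRing.isZmodClosed.Build _ (@cocycle r) (@cocycle_closed r).

Definition Zcub (r : nat) := {f : cochain r | f \in @cocycle r}.
HB.instance Definition _ r := SubChoice.on (Zcub r).
HB.instance Definition _ r := [SubChoice_isSubZmodule of Zcub r by <:].

Definition is_coboundary r : cochain r -> Prop :=
  match r with
  | 0%N => fun f => f = 0
  | r'.+1 => fun f => exists g : cochain r', f = delta g
  end.

Definition coboundary r : {pred Zcub r} := fun f => `[< is_coboundary (val f) >].

Lemma coboundary_closed r : zmod_closed (@coboundary r).
Proof.
split=> [|f g /asboolP hf /asboolP hg]; apply/asboolP.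
  by case: r => //= r; exists 0; rewrite delta0.
case: r f g hf hg => [f g /= f0 g0|r f g [f' ff] [g' gg]].
  by rewrite f0 g0 subrr.
by exists (f' - g'); rewrite deltaB -ff -gg.
Qed.

HB.instance Definition _ r :=
  GRing.isZmodClosed.Build _ (@coboundary r) (@coboundary_closed r).

Definition Hcub (r : nat) := Quotient.quot (@coboundary r).
HB.instance Definition _ r := GRing.Zmodule.on (Hcub r).

Definition class_cub r (f : Zcub r) : Hcub r := (\pi_(Hcub r) f)%qT.

(* All cochain groups in this part are only meant for [r >= 1]. *)
Definition ccochain (r : nat) := nerve L r -> A.
HB.instance Definition _ r := GRing.Zmodule.on (ccochain r).

Definition cdelta r (f : ccochain r) : ccochain r.+1 := fun s =>
  f (nbehead s) + \sum_(i < r) f (nmerge s i) *~ ((-1) ^+ i.+1)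
    + f (ntake s) *~ ((-1) ^+ r.+1).

Definition normalised r (f : ccochain r) : Prop :=
  forall s : nerve L r, has (fun la => deg la == 0) (val s) -> f s = 0.

Lemma cdeltaB r : {morph @cdelta r : f g / f - g}.
Proof.
move=> f g; apply/funext => s; rewrite -[RHS]/(cdelta f s - cdelta g s).
have e (x y z x' y' z' : A) :
    (x - x') + (y - y') + (z - z') = (x + y + z) - (x' + y' + z').
  by rewrite !opprD (addrACA x) (addrACA (x + y)).
rewrite /cdelta -e -sumrB -mulrzBl; congr (_ + _ + _).
by apply: eq_bigr => i _; rewrite -mulrzBl.
Qed.

Lemma cdelta0 r : cdelta (0 : ccochain r) = 0.
Proof. by rewrite -[X in cdelta X](subrr 0) cdeltaB subrr. Qed.

Lemma normalisedB r (f g : ccochain r) :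
  normalised f -> normalised g -> normalised (f - g).
Proof.
by move=> nf ng s hs; rewrite -[LHS]/(f s - g s) nf // ng // subrr.
Qed.

Definition ccocycle r : {pred ccochain r} :=
  fun f => `[< normalised f >] && (cdelta f == 0).

Lemma ccocycle_closed r : zmod_closed (@ccocycle r).
Proof.
split=> [|f g /andP[/asboolP nf /eqP f0] /andP[/asboolP ng /eqP g0]].
  by apply/andP; split; [apply/asboolP | rewrite cdelta0].
apply/andP; split; last by rewrite cdeltaB f0 g0 subrr.
exact/asboolP/normalisedB.
Qed.

HB.instance Definition _ r :=
  GRing.isZmodClosed.Build _ (@ccocycle r) (@ccocycle_closed r).

Definition Zcat (r : nat) := {f : ccochain r | f \in @ccocycle r}.
HB.instance Definition _ r := SubChoice.on (Zcat r).
HB.instance Definition _ r := [SubChoice_isSubZmodule of Zcat r by <:].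

Definition is_ccoboundary r : ccochain r -> Prop :=
  match r with
  | 0%N => fun f => f = 0
  | r'.+1 => fun f => exists2 g : ccochain r', normalised g & f = cdelta g
  end.

Definition ccoboundary r : {pred Zcat r} :=
  fun f => `[< is_ccoboundary (val f) >].

Lemma ccoboundary_closed r : zmod_closed (@ccoboundary r).
Proof.
split=> [|f g /asboolP hf /asboolP hg]; apply/asboolP.
  by case: r => //= r; exists 0; rewrite ?cdelta0.
case: r f g hf hg => [f g /= f0 g0|r f g [f' nf ff] [g' ng gg]].
  by rewrite f0 g0 subrr.
by exists (f' - g'); [apply: normalisedB | rewrite cdeltaB -ff -gg].
Qed.

HB.instance Definition _ r :=
  GRing.isZmodClosed.Build _ (@ccoboundary r) (@ccoboundary_closed r).

Definition Hcat (r : nat) := Quotient.quot (@ccoboundary r).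
HB.instance Definition _ r := GRing.Zmodule.on (Hcat r).

Definition class_cat r (f : Zcat r) : Hcat r := (\pi_(Hcat r) f)%qT.

(* The value on an allowable transition; [insub] succeeds by
   [allowable_at_cube], so the default values are only reached on pairs that
   are not allowable. *)
Definition transition_value (phi : cochain 2) (u w : epath L) : A :=
  if [pick i : 'I_(size (edges u)) | allowable_at i u w] is Some i then
    if drop i (edges u) is ui :: ui1 :: _ then
      oapp phi 0 (insub (mcomp (val ui) (val ui1)))
    else 0
  else 0.

Fixpoint sum_along (phi : cochain 2) (w : epath L) (ws : seq (epath L)) : A :=
  if ws is u :: ws' then transition_value phi u w + sum_along phi u ws' else 0.

(* The sum does not depend on the reduction of [w] when [phi] is a cocycle. *)
Definition shuffle (phi : cochain 2) (w : epath L) : A :=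
  sum_along phi w (reduction w).

Definition nf_cat (mu nu : L) (h : dom mu = cod nu) : epath L :=
  ecat (normal_form_composable h).

Definition shuffle2 (phi : cochain 2) (mu nu : L) (h : dom mu = cod nu) : A :=
  shuffle phi (nf_cat h).

End Cohomology.

(* Main.v *)
From HB Require Import structures.
Require Import Defs.
From mathcomp Require Import all_boot all_order all_algebra.
From mathcomp Require Import boolp functions.
Set Implicit Arguments.
Unset Strict Implicit.
Unset Printing Implicit Defensive.
Import GRing.Theory.
Local Open Scope ring_scope.

(** Everything rests on the fact that the sum of a cocycle [phi] over the
transitions of a reduction depends only on the path that is reduced. The proof
writes down the value of that sum in advance: sort the path by insertion, from
right to left, and add up the values of [phi] at the commuting squares that are
crossed. This is [sort_cost]. It vanishes on increasing paths, so the sums along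
all reductions of a path agree with it as soon as it drops by exactly the value
of [phi] across each single transition ([sort_cost_swap]).

By induction along the path, only a transition at the first two edges [e f] of
[e f s], with [s] increasing, has to be examined. Inserting [f] and then [e]
into [s] is compared with inserting [q] and then [p], where [p q = e f] is the
square with its colours put in order ([insert_cost_swap]). Moving both edges
past the first edge [g] of [s] amounts to walking round the cube [e f g] in the
two possible ways. Both ways end in the same place because factorisations are
unique ([is_swap_braid]), and they cost the same because the signed sum of [phi]
over the six faces of the cube is zero ([hexagon]).

Once [shuffle phi w] is identified with [sort_cost phi], the cocycle identity
compares two ways of sorting the concatenation of the normal forms of [x], [y]
and [z]: sorting the last two factors first, or the first two. Either way the
preliminary sorting contributes its own cost ([sort_cost_catr] and
[sort_cost_catl]).

If [phi] is the coboundary of [b], crossing the square [e f = p q] costs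
[b p + b q - b e - b f], so the cost of sorting a path is the increase of the
total of [b] along it ([sort_cost_delta]). Hence the categorical cocycle is, up
to sign, the coboundary of the total of [b] along normal forms, and the map
descends to cohomology. *)

(** * Commuting squares and insertion sort *)

Section Sorting.
Context {k : nat} {L : kgraph k}.
Implicit Types (e f g p q : edge L) (es fs s : seq (edge L)) (v : obj L).

(** The pair [(e, f)] outside composable pairs is a dummy; it keeps insertion
total. *)
Definition swap e f : edge L * edge L :=
  if pselect (dom (val e) = cod (val f)) is left c then sval (cid (swap_ex c))
  else (e, f).

(** The other side of the commuting square with side [e f]. The composability
of [e] and [f] is kept apart because it always comes from a surrounding
path. *)
Definition is_swap e f p q : Prop :=
  [/\ dom (val p) = cod (val q), colour p = colour f, colour q = colour e
    & mcomp (val p) (val q) = mcomp (val e) (val f)].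

Lemma swapP e f : dom (val e) = cod (val f) ->
  is_swap e f (swap e f).1 (swap e f).2.
Proof. by rewrite /swap => c; case: pselect => // c'; case: cid. Qed.

Lemma swap_unique e f p q :
  dom (val e) = cod (val f) -> is_swap e f p q -> swap e f = (p, q).
Proof.
move=> c [c' cp cq m]; have [c1 cp1 cq1 m1] := swapP c.
have [|||ep eq] := factor_unique c1 c'.
- by rewrite m1 m.
- by rewrite !deg_edge cp1 cp.
- by rewrite !deg_edge cq1 cq.
by rewrite [LHS]surjective_pairing (val_inj ep) (val_inj eq).
Qed.

Lemma is_swap_cod e f p q : dom (val e) = cod (val f) -> is_swap e f p q ->
  cod (val p) = cod (val e).
Proof. by move=> c [c1 _ _ m]; rewrite -(cod_comp c1) m cod_comp. Qed.

Lemma is_swap_dom e f p q : dom (val e) = cod (val f) -> is_swap e f p q ->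
  dom (val q) = dom (val f).
Proof. by move=> c [c1 _ _ m]; rewrite -(dom_comp c1) m dom_comp. Qed.

(** A square may be crossed anywhere inside a path: it has the same corners on
both sides. *)
Lemma epath_swap v es1 e f p q es2 :
    is_epath v (es1 ++ [:: e, f & es2]) -> is_swap e f p q ->
  is_epath v (es1 ++ [:: p, q & es2]) /\
  seq_pi v (es1 ++ [:: p, q & es2]) = seq_pi v (es1 ++ [:: e, f & es2]).
Proof.
move=> pe S; elim: es1 v pe => [|x es1 IH] v /=.
  case/and3P=> /eqP cv /eqP/esym c pes; have [c1 _ _ m] := S.
  rewrite (is_swap_cod c S) (is_swap_dom c S) c1 cv !eqxx.
  by rewrite !Defs.compA ?cod_seq_pi ?(is_swap_dom c S) ?m.
by case/andP=> -> /IH[-> ->].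
Qed.

Lemma seq_pi_cat v es fs : is_epath v (es ++ fs) ->
  seq_pi v (es ++ fs) = mcomp (seq_pi v es) (seq_pi (seq_source v es) fs).
Proof.
elim: es v => [|e es IH] v /=.
  by move=> p; rewrite -{2}(cod_seq_pi p) comp_idl.
case/andP=> _ p; rewrite IH // Defs.compA //.
  by rewrite cod_seq_pi //; move: p; rewrite is_epath_cat => /andP[].
move: p; rewrite is_epath_cat => /andP[p1 p2].
by rewrite dom_seq_pi // cod_seq_pi.
Qed.

Fixpoint insert e s : seq (edge L) :=
  if s is f :: s' then
    if (colour e <= colour f)%N then e :: s
    else (swap e f).1 :: insert (swap e f).2 s'
  else [:: e].

Definition esort es : seq (edge L) := foldr insert [::] es.

Lemma insert_path v e s : is_epath v (e :: s) ->
  is_epath v (insert e s) /\ seq_pi v (insert e s) = seq_pi v (e :: s).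
Proof.
elim: s v e => [|f s IH] v e // pe /=.
case: ifP => // _; rewrite -/(seq_pi v (e :: f :: s)).
have S := swapP (esym (eqP (andP (andP pe).2).1)).
have [/= /andP[-> pq] <-] := epath_swap (es1 := [::]) pe S.
by have [-> ->] := IH _ _ pq.
Qed.

(** The degree of the composite records which colours occur. *)
Lemma mem_colour_pi v es fs : is_epath v es -> is_epath v fs ->
  seq_pi v es = seq_pi v fs -> map (@colour _ L) es =i map (@colour _ L) fs.
Proof. by move=> pe pf E i; rewrite -!sum_gen_gt0 -!(@deg_seq_pi _ _ v) ?E. Qed.

Lemma increasing_cons e es :
  increasing (e :: es) =
    all (fun i : 'I_k => colour e <= i)%N (map (@colour _ L) es)
      && increasing es.
Proof.
by rewrite /increasing /= (path_sortedE (@colour_le_trans _ L)) all_map.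
Qed.

Lemma insert_id e s : increasing (e :: s) -> insert e s = e :: s.
Proof. by case: s => //= f s /andP[-> _]. Qed.

(** The head of the result is the smallest colour, because the tail has the
colours of the path it was obtained from. *)
Lemma insert_increasing v e s : is_epath v (e :: s) -> increasing s ->
  increasing (insert e s).
Proof.
elim: s v e => [|f s IH] v e // pe incs.
have := incs; rewrite increasing_cons => /andP[lef ss].
rewrite /=; case: leqP => [ef|fe]; first by rewrite /increasing /= ef.
have S := swapP (esym (eqP (andP (andP pe).2).1)).
have pq : is_epath (dom (val (swap e f).1)) ((swap e f).2 :: s).
  by have [/andP[]] := epath_swap (es1 := [::]) pe S.
have [_ cp cq _] := S.
rewrite increasing_cons (IH _ _ pq ss) andbT.
have [pi1 pi2] := insert_path pq.
rewrite (eq_all_r (mem_colour_pi pi1 pq pi2)) /= cp cq (ltnW fe) /=.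
exact: lef.
Qed.

Lemma esort_spec v es : is_epath v es ->
  [/\ is_epath v (esort es), seq_pi v (esort es) = seq_pi v es
    & increasing (esort es)].
Proof.
elim: es v => [|e es IH] v //= /andP[cv /IH[p1 p2 p3]].
have pe : is_epath v (e :: esort es) by rewrite /= cv.
have [q1 q2] := insert_path pe.
by rewrite q2 /= p2; split=> //; apply: insert_increasing pe p3.
Qed.

(** Increasing paths are determined by their composite, so sorting forgets
everything else. *)
Lemma esort_eq v es fs : is_epath v es -> is_epath v fs ->
  seq_pi v es = seq_pi v fs -> esort es = esort fs.
Proof.
move=> /esort_spec[p1 p2 p3] /esort_spec[q1 q2 q3] E.
by apply: (increasing_unique p1 q1) => //; rewrite p2 q2.
Qed.

Lemma esort_id es : increasing es -> esort es = es.
Proof.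
elim: es => //= e es IH inc; rewrite IH; last exact: path_sorted inc.
exact: insert_id.
Qed.

Lemma increasing_nf v es la : is_epath v es -> seq_pi v es = la ->
  increasing es -> edges (normal_form la) = es.
Proof.
by move=> pe E inc; rewrite -(@normal_form_unique _ _ la (exist _ (v, es) pe)).
Qed.

Lemma esort_nf v es : is_epath v es ->
  esort es = edges (normal_form (seq_pi v es)).
Proof.
by case/esort_spec=> p1 p2 p3; rewrite (increasing_nf p1 p2).
Qed.

(** Two routes round the cube [e f g], from [e f g] to the path with the three
colours in reverse order: through [e g1 f1] and [g2 e1 f1], or through [p q g],
[p h1 q1] and [h2 p1 q1]. The factorisation of the cube by the colour of [g]
first makes the routes meet, after one more square on the first of them. *)
Lemma is_swap_braid e f g p q g1 f1 g2 e1 h1 q1 h2 p1 :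
    dom (val e) = cod (val f) -> dom (val f) = cod (val g) ->
    is_swap e f p q -> is_swap f g g1 f1 -> is_swap e g1 g2 e1 ->
    is_swap q g h1 q1 -> is_swap p h1 h2 p1 ->
  [/\ g2 = h2, dom (val e1) = cod (val f1) & is_swap e1 f1 p1 q1].
Proof.
move=> cef cfg Sef Sfg.
have ceg1 : dom (val e) = cod (val g1) by rewrite cef (is_swap_cod cfg Sfg).
move=> Seg Sqg.
have cqg : dom (val q) = cod (val g) by rewrite (is_swap_dom cef Sef).
have [cpq cp cq mpq] := Sef.
have cph1 : dom (val p) = cod (val h1) by rewrite cpq (is_swap_cod cqg Sqg).
move=> Sph.
have [cgf cg1 cf1 mgf] := Sfg; have [cge cg2 ce1 mge] := Seg.
have [chq ch1 cq1 mhq] := Sqg; have [chp ch2 cp1 mhp] := Sph.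
have cef1 : dom (val e1) = cod (val f1) by rewrite (is_swap_dom ceg1 Seg).
have cpq1 : dom (val p1) = cod (val q1) by rewrite (is_swap_dom cph1 Sph).
have [|||||eg em] := @factor_unique _ L (val g2) (mcomp (val e1) (val f1))
  (val h2) (mcomp (val p1) (val q1)).
- by rewrite cod_comp.
- by rewrite cod_comp.
- rewrite !Defs.compA // mge mhp -!Defs.compA // mgf mhq !Defs.compA // mpq.
  by [].
- by rewrite !deg_edge cg2 ch2 cg1 ch1.
- by rewrite !deg_comp // !deg_edge ce1 cf1 cp1 cq1 cp cq addrC.
by split=> //; [apply: val_inj | split; rewrite ?cp1 ?cq1 ?cp ?cq].
Qed.

(** Cancelling the common edges on both sides by unique factorisation: two
paths with equal composites that differ in two places differ by a
square. *)
Lemma is_swap_pi v es1 e f p q es2 :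
    is_epath v (es1 ++ [:: e, f & es2]) ->
    is_epath v (es1 ++ [:: p, q & es2]) ->
    seq_pi v (es1 ++ [:: p, q & es2]) = seq_pi v (es1 ++ [:: e, f & es2]) ->
    colour p = colour f -> colour q = colour e -> is_swap e f p q.
Proof.
move=> pe pp E cp cq; elim: es1 v pe pp E => [|x es1 IH] v /=.
  move=> /and3P[_ /eqP/esym c1 p1] /and3P[_ /eqP/esym c2 p2].
  rewrite !Defs.compA ?cod_seq_pi // => E; split=> //.
  have [||||-> //] := factor_unique _ _ E; rewrite ?dom_comp ?cod_seq_pi //.
    by rewrite !deg_comp // !deg_edge cp cq addrC.
  by rewrite !deg_seq_pi.
move=> /andP[_ p1] /andP[_ p2] E; apply: (IH _ p1 p2).
have [||||_ //] := factor_unique _ _ E; rewrite ?cod_seq_pi //.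
rewrite !deg_seq_pi // !big_cat !big_cons /= cp cq; congr (_ + _).
by rewrite addrCA.
Qed.

End Sorting.

(** * Faces of cubes *)

Section Faces.
Context {k : nat} {L : kgraph k}.

Lemma deg_addIr (m n d : {ffun 'I_k -> nat}) : m + d = n + d -> m = n.
Proof.
by move=> /ffunP E; apply/ffunP=> i; have := E i; rewrite !ffunE => /addIn.
Qed.

Lemma face_false r (q : cube L r.+1) j (a b : L) : dom a = cod b ->
  mcomp a b = val q -> deg b = gen (colour_at q j) -> val (face false q j) = a.
Proof.
move=> c m db; rewrite /= /face_mor; set h := subdegK _.
have [c' d1 d2 m'] := factorP h.
have [|||<- //] := factor_unique c' c; rewrite ?m ?m' ?d2 //.
have : deg (val q) = deg a + gen (colour_at q j) by rewrite -m deg_comp // db.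
by rewrite {1}h d1 => /deg_addIr.
Qed.

Lemma face_true r (q : cube L r.+1) j (a b : L) : dom a = cod b ->
  mcomp a b = val q -> deg a = gen (colour_at q j) -> val (face true q j) = b.
Proof.
move=> c m db; rewrite /= /face_mor; set h := subdegKC _.
have [c' d1 d2 m'] := factorP h.
have [|||_ <- //] := factor_unique c' c; rewrite ?m ?m' ?d1 //.
have : deg (val q) = gen (colour_at q j) + deg b by rewrite -m deg_comp // db.
by rewrite {1}h d2 ![gen _ + _]addrC => /deg_addIr.
Qed.

(** The colours of a cube are listed in increasing order, so exhibiting any
increasing list of them identifies it. *)
Lemma colours_eq (la : L) (s : seq 'I_k) :
  sorted (fun i j : 'I_k => i < j)%N s -> s =i [pred i | 0 < deg la i]%N ->
  colours la = s.
Proof.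
move=> ss es; have tr : transitive (fun i j : 'I_k => i < j)%N.
  by move=> x y z; apply: ltn_trans.
apply: (irr_sorted_eq tr) => //.
- by move=> i; rewrite /= ltnn.
- rewrite /colours sorted_filter //.
  by have := iota_ltn_sorted 0 k; rewrite -val_enum_ord sorted_map.
- by move=> i; rewrite mem_filter es mem_enum andbT.
Qed.

Lemma colour_atE r (q : cube L r) (s : seq 'I_k) j i0 :
  colours (val q) = s -> colour_at q j = nth i0 s j.
Proof. by move=> <-; rewrite /colour_at (tnth_nth i0). Qed.

End Faces.

Section Cubes.
Context {k : nat} {L : kgraph k} {A : zmodType}.
Implicit Types (e f g p q : edge L) (es fs s : seq (edge L)) (v : obj L).

(** Extension by zero: values at composites can then be compared by rewriting,
without carrying proofs that the composites are cubes. *)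
Definition ext r (phi : cochain L A r) (x : L) : A := oapp phi 0 (insub x).

Lemma ext_val r (phi : cochain L A r) (c : cube L r) : ext phi (val c) = phi c.
Proof. by rewrite /ext valK. Qed.

(** Counting pairs of opposite faces from 0 instead of 1 flips their signs, so
the second face of each pair comes with the positive one. *)
Lemma deltaE r (phi : cochain L A r) (c : cube L r.+1) :
  delta phi c = \sum_(j < r.+1)
    (ext phi (val (face true c j)) - ext phi (val (face false c j)))
      *~ ((-1) ^+ j).
Proof.
apply: eq_bigr => j _; rewrite big_bool !ext_val /=.
rewrite addn1 addn0 !exprS !mulN1r opprK.
by rewrite mulrNz mulrzBl.
Qed.

Lemma delta_square (phi : cochain L A 1) e f :
  dom (val e) = cod (val f) -> (colour f < colour e)%N ->
  let p := (swap e f).1 in let q := (swap e f).2 in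
  ext (delta phi) (mcomp (val e) (val f)) =
    ext phi (val p) + ext phi (val q) - ext phi (val e) - ext phi (val f).
Proof.
move=> c fe p q; have [c1 cp cq m] := swapP c.
have ne : colour e != colour f by rewrite neq_ltn fe orbT.
pose x : cube L 2 :=
  exist (fun x => is_true (is_cube 2 x)) _ (edges_square c ne).
have cx : colours (val x) = [:: colour f; colour e].
  apply: colours_eq => [|i] /=; first by rewrite fe.
  rewrite !inE deg_comp // !deg_edge !ffunE !(eq_sym i).
  by do 2!case: eqP.
have at0 : colour_at x ord0 = colour f by rewrite (colour_atE _ (colour f) cx).
have at1 : colour_at x (lift ord0 ord0) = colour e.
  by rewrite (colour_atE _ (colour f) cx).
rewrite -[mcomp _ _]/(val x) ext_val deltaE !big_ord_recl big_ord0 addr0.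
rewrite (@face_false _ _ _ _ _ (val e) (val f)) ?at0 ?deg_edge //.
rewrite (@face_true _ _ _ _ _ (val p) (val q)) ?at0 ?deg_edge ?cp //.
rewrite (@face_false _ _ _ _ _ (val p) (val q)) ?at1 ?deg_edge ?cq //.
rewrite (@face_true _ _ _ _ _ (val e) (val f)) ?at1 ?deg_edge //.
rewrite expr0 expr1 mulr1z mulrNz mulr1z opprB.
by rewrite addrACA [X in X + _ = _]addrC !addrA.
Qed.

(** The cocycle identity on the cube [e f g]. Its faces are the squares crossed
by the two routes of [is_swap_braid]: each route crosses three faces, one from
each pair of opposite faces. *)
Lemma hexagon (phi : cochain L A 2) e f g p q g1 f1 g2 e1 h1 q1 h2 p1 :
    delta phi = 0 -> (colour g < colour f < colour e)%N ->
    dom (val e) = cod (val f) -> dom (val f) = cod (val g) ->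
    is_swap e f p q -> is_swap f g g1 f1 -> is_swap e g1 g2 e1 ->
    is_swap q g h1 q1 -> is_swap p h1 h2 p1 ->
  let F (a b : edge L) := ext phi (mcomp (val a) (val b)) in
  F f g + F e g1 + F e1 f1 = F e f + F q g + F p h1.
Proof.
move=> phi0 /andP[gf fe] cef cfg Sef Sfg Seg Sqg Sph F.
have [eh cef1 Sef1] := is_swap_braid cef cfg Sef Sfg Seg Sqg Sph; subst h2.
have ge := ltn_trans gf fe.
have ceg1 : dom (val e) = cod (val g1) by rewrite cef (is_swap_cod cfg Sfg).
have cqg : dom (val q) = cod (val g) by rewrite (is_swap_dom cef Sef).
have [cpq cp cq mpq] := Sef.
have cph1 : dom (val p) = cod (val h1) by rewrite cpq (is_swap_cod cqg Sqg).
have [cgf cg1 cf1 mgf] := Sfg; have [cge cg2 ce1 mge] := Seg.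
have [chq ch1 cq1 mhq] := Sqg; have [chp ch2 cp1 mhp] := Sph.
pose x := mcomp (val e) (mcomp (val f) (val g)).
have dx : deg x = gen (colour e) + (gen (colour f) + gen (colour g)).
  by rewrite !deg_comp ?cod_comp // !deg_edge.
have x3 : is_cube 3 x.
  rewrite /is_cube dx !tdegD !tdeg_gen eqxx andbT; apply/forallP => i.
  rewrite !ffunE; case: eqP => [<-|_].
    by rewrite -!val_eqE /= (ltn_eqF fe) (ltn_eqF ge).
  by case: eqP => [<-|_]; rewrite -?val_eqE /= ?(ltn_eqF gf) //; case: eqP.
pose c : cube L 3 := exist _ x x3.
have cx : colours (val c) = [:: colour g; colour f; colour e].
  apply: colours_eq => [|i] /=; first by rewrite gf fe.
  rewrite !inE dx !ffunE !(eq_sym i).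
  by do 3!case: eqP.
have at0 : colour_at c ord0 = colour g by rewrite (colour_atE _ (colour f) cx).
have at1 : colour_at c (lift ord0 ord0) = colour f.
  by rewrite (colour_atE _ (colour f) cx).
have at2 : colour_at c (lift ord0 (lift ord0 ord0)) = colour e.
  by rewrite (colour_atE _ (colour f) cx).
(* The three factorisations of the cube by each colour in turn, on the right
and on the left, give its six faces. *)
have := congr1 (fun h => h c) phi0.
rewrite [X in _ = X]/(0 : A).
rewrite deltaE !big_ord_recl big_ord0 addr0.
have xe : x = mcomp (mcomp (val e) (val f)) (val g) by rewrite /x Defs.compA.
have xg : x = mcomp (val g2) (mcomp (val e1) (val f1)).
  by rewrite Defs.compA // mge -Defs.compA // mgf.
have xf : x = mcomp (mcomp (val e) (val g1)) (val f1).
  by rewrite -Defs.compA // mgf.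
have xp : x = mcomp (val p) (mcomp (val q) (val g)).
  by rewrite Defs.compA // mpq -xe.
have xq : x = mcomp (mcomp (val p) (val h1)) (val q1).
  by rewrite -Defs.compA // mhq.
rewrite (@face_false _ _ _ _ _ (mcomp (val e) (val f)) (val g))
  ?dom_comp ?at0 ?deg_edge //.
rewrite (@face_true _ _ _ _ _ (val g2) (mcomp (val e1) (val f1)))
  ?cod_comp ?at0 ?deg_edge ?cg2 ?cg1 //.
rewrite (@face_false _ _ _ _ _ (mcomp (val e) (val g1)) (val f1))
  ?dom_comp ?at1 ?deg_edge ?cf1 //.
rewrite (@face_true _ _ _ _ _ (val p) (mcomp (val q) (val g)))
  ?cod_comp ?at1 ?deg_edge ?cp //.
rewrite (@face_false _ _ _ _ _ (mcomp (val p) (val h1)) (val q1))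
  ?dom_comp ?at2 ?deg_edge ?cq1 ?cq //.
rewrite (@face_true _ _ _ _ _ (val e) (mcomp (val f) (val g)))
  ?cod_comp ?at2 ?deg_edge //.
rewrite -/(F e f) -/(F e1 f1) -/(F e g1) -/(F q g) -/(F p h1) -/(F f g).
rewrite expr0 expr1 sqrrN expr1n !mulr1z mulrNz mulr1z opprB => E.
apply/eqP; rewrite -subr_eq0 -[X in _ == X]E; apply/eqP.
rewrite (addrACA (F e g1)) (addrACA (F e1 f1)) -!opprD.
by congr (_ - _); rewrite ?addrA // addrC addrA addrAC.
Qed.

(** * The cost of sorting a path *)

Section Potential.
Variable phi : cochain L A 2.
Let F e f := ext phi (mcomp (val e) (val f)).

(** The total of [phi] over the squares crossed by [insert e s]. *)
Fixpoint insert_cost e s : A :=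
  if s is f :: s' then
    if (colour e <= colour f)%N then 0
    else F e f + insert_cost (swap e f).2 s'
  else 0.

Fixpoint sort_cost es : A :=
  if es is e :: es' then sort_cost es' + insert_cost e (esort es') else 0.

Lemma sort_cost_increasing es : increasing es -> sort_cost es = 0.
Proof.
elim: es => //= e es IH inc.
have incs : increasing es by apply: path_sorted inc.
rewrite IH // esort_id // add0r.
by case: es inc {IH incs} => //= f es /andP[-> _].
Qed.

Hypothesis phi0 : delta phi = 0.

(** Induction on [s]. If the colour of [f] is at most that of the head [g],
then [f] stays in front of [g], and the single square [e f] is the whole
difference. Otherwise both [f] and [e] (respectively [q] and [p]) move past
[g]; [hexagon] accounts for the cube [e f g], and what remains is the same
statement for the square [e1 f1] on the far side of [g]. *)
Lemma insert_cost_swap v e f s p q :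
    is_epath v [:: e, f & s] -> increasing s -> (colour f < colour e)%N ->
    is_swap e f p q ->
  insert_cost f s + insert_cost e (insert f s) =
    F e f + (insert_cost q s + insert_cost p (insert q s)).
Proof.
elim: s v e f p q => [|g s IH] v e f p q pe incs fe S.
  have [_ cp cq _] := S.
  by rewrite /= leqNgt fe /= cp cq (ltnW fe) !addr0 add0r.
have [/eqP cv [/eqP/esym cef [/eqP/esym cfg pes]]] :
    cod (val e) == v /\ cod (val f) == dom (val e) /\
    cod (val g) == dom (val f) /\ is_epath (dom (val g)) s.
  by move: pe => /= /and4P[].
have incs' : increasing s by apply: path_sorted incs.
have [cpq cp cq mpq] := S.
rewrite /=; case: (leqP (colour f) (colour g)) => [fg|gf].
  rewrite /= (leqNgt (colour e)) fe /= (swap_unique cef S) /= add0r.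
  case: leqP => _ /=; first by rewrite cp cq (ltnW fe) !addr0.
  have cqg : dom (val q) = cod (val g) by rewrite (is_swap_dom cef S).
  by have [_ -> _ _] := swapP cqg; rewrite cp fg addr0.
have Sfg := swapP cfg; have [cgf cg1 cf1 mgf] := Sfg.
move: (swap f g).1 (swap f g).2 Sfg cgf cg1 cf1 mgf.
move=> g1 f1 Sfg cgf cg1 cf1 mgf.
have ge := ltn_trans gf fe.
rewrite /= cg1 cq (ltn_geF ge) /=.
have ceg1 : dom (val e) = cod (val g1) by rewrite cef (is_swap_cod cfg Sfg).
have cqg : dom (val q) = cod (val g) by rewrite (is_swap_dom cef S).
have Seg := swapP ceg1; have Sqg := swapP cqg.
move: (swap e g1).1 (swap e g1).2 Seg => g2 e1 Seg.
move: (swap q g).1 (swap q g).2 Sqg => h1 q1 Sqg.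
have cph1 : dom (val p) = cod (val h1) by rewrite cpq (is_swap_cod cqg Sqg).
have [_ ch1 _ _] := Sqg; rewrite ch1 cp (ltn_geF gf) /=.
have Sph := swapP cph1; move: (swap p h1).1 (swap p h1).2 Sph => h2 p1 Sph.
have [_ cef1 Sef1] := is_swap_braid cef cfg S Sfg Seg Sqg Sph.
have gfe : (colour g < colour f < colour e)%N by rewrite gf.
have hex := hexagon phi0 gfe cef cfg S Sfg Seg Sqg Sph.
have [_ _ ce1 _] := Seg.
have pe1 : is_epath (cod (val e1)) [:: e1, f1 & s].
  by rewrite /= eqxx cef1 (is_swap_dom cfg Sfg) eqxx.
have := IH _ _ _ _ _ pe1 incs' _ Sef1; rewrite ce1 cf1 => /(_ fe) IHs.
rewrite addrACA IHs addrA -/(F f g) -/(F e g1) -/(F e1 f1) in hex *.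
by rewrite hex -!addrA; congr (_ + (_ + _)); rewrite addrCA.
Qed.

(** A transition further right leaves the composite, hence the sorted tail,
unchanged; so it affects only the cost of sorting that tail, and
[insert_cost_swap] settles a transition at the front. *)
Lemma sort_cost_swap v es1 e f p q es2 :
    is_epath v (es1 ++ [:: e, f & es2]) -> (colour f < colour e)%N ->
    is_swap e f p q ->
  sort_cost (es1 ++ [:: e, f & es2]) =
    F e f + sort_cost (es1 ++ [:: p, q & es2]).
Proof.
elim: es1 v => [|x es1 IH] v pe fe S.
  have [/eqP cv [/eqP/esym cef pes]] : cod (val e) == v /\
      cod (val f) == dom (val e) /\ is_epath (dom (val f)) es2.
    by move: pe => /= /and3P[-> -> ->].
  have [p1 p2 p3] := esort_spec pes.
  have pe' : is_epath v [:: e, f & esort es2] by rewrite /= cv cef p1 !eqxx.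
  by rewrite /= -!addrA (insert_cost_swap pe' p3 fe S) [LHS]addrCA.
have /andP[_ pes] : (cod (val x) == v) &&
  is_epath (dom (val x)) (es1 ++ [:: e, f & es2]) by [].
rewrite /= (IH _ pes fe S) -addrA; congr (_ + (_ + insert_cost _ _)).
by have [pp E] := epath_swap pes S; apply: (esort_eq pes pp (esym E)).
Qed.

(** The position that defines the value of a transition is chosen arbitrarily
among the admissible ones, but the cost drops by the corresponding value at each
of them. *)
Lemma transition_sort_cost (u w : epath L) : allowable u w ->
  sort_cost (edges w) = transition_value phi u w + sort_cost (edges u).
Proof.
case/existsP => i0 ai0; rewrite /transition_value.
case: pickP => [i|/(_ i0)]; last by rewrite ai0.
case: i {i0 ai0} => i /= _ /and4P[/eqP epi /eqP et /eqP ed].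
case du: (drop i (edges u)) => [|p [|q es2]] //.
case dw: (drop i (edges w)) => [|e [|f es3]] // /and3P[/eqP fp pq /eqP qe].
have pu : is_epath (erange w) (edges u).
  by rewrite -cod_pi -epi cod_pi; apply: valP u.
have pw : is_epath (erange w) (edges w) by apply: valP w.
have E : seq_pi (erange w) (edges u) = seq_pi (erange w) (edges w).
  by rewrite -[RHS]/(Defs.pi w) -epi /Defs.pi -(cod_pi u) epi cod_pi.
have eu : edges u = take i (edges w) ++ [:: p, q & es2].
  by rewrite -et -du cat_take_drop.
have ew : edges w = take i (edges w) ++ [:: e, f & es2].
  have -> : es2 = es3.
    by move: ed; rewrite -addn2 addnC -!drop_drop du dw /= !drop0.
  by rewrite -dw cat_take_drop.
move: (take i (edges w)) eu ew => es1 eu ew; rewrite eu ew in pu pw E *.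
have S := is_swap_pi pw pu E (esym fp) qe; have [_ _ _ m] := S.
have fe : (colour f < colour e)%N by rewrite fp -qe.
by rewrite (sort_cost_swap pw fe S) /F -m.
Qed.

End Potential.

(** * The shuffle function *)

Lemma sum_along_sort_cost (phi : cochain L A 2) w ws : delta phi = 0 ->
  path (fun w u => allowable u w) w ws ->
  sum_along phi w ws =
    sort_cost phi (edges w) - sort_cost phi (edges (last w ws)).
Proof.
move=> phi0; elim: ws w => [|u ws IH] w /=; first by rewrite subrr.
by case/andP=> uw /IH->; rewrite (transition_sort_cost phi0 uw) addrA.
Qed.

(** The sum telescopes and the cost of a normal form is zero; in particular the
chosen reduction is irrelevant. *)
Lemma shuffleE (phi : cochain L A 2) w : delta phi = 0 ->
  shuffle phi w = sort_cost phi (edges w).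
Proof.
move=> phi0; have /andP[p /eqP e] := reductionP w.
rewrite /shuffle (sum_along_sort_cost phi0 p) e.
by rewrite (sort_cost_increasing _ (increasing_normal_form _)) subr0.
Qed.

Lemma sort_costB (phi psi : cochain L A 2) es :
  sort_cost (phi - psi) es = sort_cost phi es - sort_cost psi es.
Proof.
have extB x : ext (phi - psi) x = ext phi x - ext psi x.
  by rewrite /ext; case: insub => //=; rewrite subrr.
have costB e s :
    insert_cost (phi - psi) e s = insert_cost phi e s - insert_cost psi e s.
  elim: s e => [|f s IH] e /=; first by rewrite subrr.
  by case: ifP => _; rewrite ?subrr // extB IH opprD addrACA.
elim: es => [|e es IH] /=; first by rewrite subrr.
by rewrite IH costB opprD addrACA.
Qed.

(** Sorting works from right to left, so it begins by sorting [fs]. *)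
Lemma sort_cost_catr (phi : cochain L A 2) v es fs : is_epath v (es ++ fs) ->
  sort_cost phi (es ++ fs) = sort_cost phi fs + sort_cost phi (es ++ esort fs).
Proof.
elim: es v => [|e es IH] v.
  case/esort_spec=> _ _ inc.
  by rewrite [X in _ + X]sort_cost_increasing // addr0.
move=> pe; have /andP[_ pes] : (cod (val e) == v) &&
  is_epath (dom (val e)) (es ++ fs) by [].
rewrite /= (IH _ pes) addrA; congr (_ + insert_cost _ _ _).
move: (pes); rewrite is_epath_cat => /andP[p1 /esort_spec[q1 q2 _]].
have pes' : is_epath (dom (val e)) (es ++ esort fs) by rewrite is_epath_cat p1.
by apply: (esort_eq pes pes'); rewrite !seq_pi_cat // q2.
Qed.

(** Not how insertion sort proceeds, but any reduction of [es] is also a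
reduction inside [es ++ fs] crossing the same squares. *)
Lemma sort_cost_catl (phi : cochain L A 2) v es fs : delta phi = 0 ->
    is_epath v (es ++ fs) ->
  sort_cost phi (es ++ fs) = sort_cost phi es + sort_cost phi (esort es ++ fs).
Proof.
move=> phi0 pe; have := pe; rewrite is_epath_cat => /andP[p1 p2].
have [gs r /andP[pg incg]] := swap_red_sort p1.
have -> : esort es = gs.
  have [] := swap_red_reduces p1 pg r.
  by move=> E _; rewrite (esort_eq p1 pg E) esort_id.
have -> : sort_cost phi es = sort_cost phi es - sort_cost phi gs.
  by rewrite [X in _ - X]sort_cost_increasing // subr0.
elim: r p1 pe {p2 pg incg} => [hs _ _|]; first by rewrite subrr add0r.
move=> es1 e f p q es2 hs pp E cp cq fe r IH p1 pe.
have S := is_swap_pi p1 pp E cp cq.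
rewrite -catA /= in pe *; have [pp2 _] := epath_swap pe S.
rewrite (sort_cost_swap phi0 p1 fe S) (sort_cost_swap phi0 pe fe S) -!addrA.
by rewrite [X in _ = _ + X]addrA -IH // -catA.
Qed.

(** * The cost of sorting for a coboundary *)

Section Boundary.
Variable b : cochain L A 1.
Let G es := \sum_(e <- es) ext b (val e).

(** Crossing a square replaces [b e + b f] by [b p + b q], at cost the
difference. *)
Lemma insert_cost_delta v e s : is_epath v (e :: s) ->
  insert_cost (delta b) e s = G (insert e s) - G (e :: s).
Proof.
elim: s v e => [|f s IH] v e pe /=; first by rewrite subrr.
case: leqP => [_|fe]; first by rewrite subrr.
have cef : dom (val e) = cod (val f) by have /and3P[_ /eqP -> _] := pe.
have [/andP[_ pq] _] := epath_swap (es1 := [::]) pe (swapP cef).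
rewrite (IH _ _ pq) delta_square // /G !big_cons !opprD !addrA.
(* The two values at the second component of the swap cancel. *)
by rewrite [LHS](ACl (1*5*3*4*7*(2*6)))%AC /= subrr addr0.
Qed.

Lemma sort_cost_delta v es : is_epath v es ->
  sort_cost (delta b) es = G (esort es) - G es.
Proof.
elim: es v => [|e es IH] v /=; first by rewrite subrr.
move=> /andP[cv pes]; have [q1 q2 q3] := esort_spec pes.
rewrite (@insert_cost_delta v) ?(IH _ pes) /= ?cv // /G !big_cons.
(* The total of the sorted tail cancels. *)
by rewrite !opprD !addrA [LHS](ACl (3*4*2*(1*5)))%AC /= subrr addr0.
Qed.
End Boundary.

End Cubes.

(** * Concatenated normal forms *)

Section NormalForms.
Context {k : nat} {L : kgraph k}.
Implicit Types (mu nu la : L).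

Definition nf la : seq (edge L) := edges (normal_form la).

Lemma nf_path la : is_epath (cod la) (nf la).
Proof.
by rewrite -{1}(pi_normal_form la) cod_pi; apply: (valP (normal_form la)).
Qed.

Lemma nf_pi la : seq_pi (cod la) (nf la) = la.
Proof. by rewrite -{1}(pi_normal_form la) cod_pi; apply: pi_normal_form. Qed.

Lemma nf_increasing la : increasing (nf la).
Proof. exact: increasing_normal_form. Qed.

Lemma nf_source la : seq_source (cod la) (nf la) = dom la.
Proof. by rewrite -dom_seq_pi ?nf_path // nf_pi. Qed.

Lemma nf_deg0 la : deg la = 0 -> nf la = [::].
Proof.
by move=> /deg0_id->; apply: (@increasing_nf _ _ (cod la) [::]).
Qed.

Lemma nf_edge (e : edge L) : nf (val e) = [:: e].
Proof.
apply: (@increasing_nf _ _ (cod (val e))); rewrite /= ?eqxx //.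
by rewrite comp_idr.
Qed.

Lemma nf_cat_path mu nu : dom mu = cod nu -> is_epath (cod mu) (nf mu ++ nf nu).
Proof. by move=> c; rewrite is_epath_cat nf_path nf_source c nf_path. Qed.

Lemma nf_cat_pi mu nu : dom mu = cod nu ->
  seq_pi (cod mu) (nf mu ++ nf nu) = mcomp mu nu.
Proof.
by move=> c; rewrite seq_pi_cat ?nf_cat_path // nf_source c !nf_pi.
Qed.

Lemma esort_nf_cat mu nu : dom mu = cod nu ->
  esort (nf mu ++ nf nu) = nf (mcomp mu nu).
Proof. by move=> c; rewrite (esort_nf (nf_cat_path c)) nf_cat_pi. Qed.

End NormalForms.

(** * The categorical cocycle and the map in cohomology *)

Section CategoricalCocycle.
Context {k : nat} {L : kgraph k} {A : zmodType}.
Implicit Types (mu nu la : L) (phi : cochain L A 2).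

(** Concatenating a list of normal forms rather than exactly two avoids a case
analysis in the definition. *)
Definition cat_cochain phi : ccochain L A 2 :=
  fun s => sort_cost phi (flatten (map nf (val s))).

Lemma cat_cochainE phi (s : nerve L 2) mu nu :
  val s = [:: mu; nu] -> cat_cochain phi s = sort_cost phi (nf mu ++ nf nu).
Proof. by rewrite /cat_cochain => -> /=; rewrite cats0. Qed.

Lemma nerve2P (s : nerve L 2) :
  exists mu nu, val s = [:: mu; nu] /\ dom mu = cod nu.
Proof.
case: s => -[|x [|y [|z s]]] //= p; exists x, y; split=> //.
by move: p; rewrite andbT => /eqP.
Qed.

Lemma nerve3P (s : nerve L 3) :
  exists x y z, [/\ val s = [:: x; y; z], dom x = cod y & dom y = cod z].
Proof.
case: s => -[|x [|y [|z [|t s]]]] //= p; exists x, y, z.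
by move: p; rewrite andbT => /andP[/eqP ? /eqP ?].
Qed.

Lemma cat_cochain_normalised phi : normalised (cat_cochain phi).
Proof.
move=> s; have [mu [nu [E c]]] := nerve2P s; rewrite (cat_cochainE _ E) E /=.
rewrite orbF => /orP[]/eqP/nf_deg0->; rewrite ?cats0;
  exact/sort_cost_increasing/nf_increasing.
Qed.

Lemma mulrz_sign (a : A) n : a *~ ((-1) ^+ n) = if odd n then - a else a.
Proof. by rewrite -signr_odd; case: odd; rewrite ?mulrNz. Qed.

(** Both [c(y, z) + c(x, y z)] and [c(x, y) + c(x y, z)] are the cost of
sorting the concatenated normal forms of [x], [y] and [z]. *)
Lemma cdelta_cat_cochain phi : delta phi = 0 -> cdelta (cat_cochain phi) = 0.
Proof.
move=> phi0; apply/funext => s; rewrite [RHS]/(0 : A).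
have [x [y [z [E cxy cyz]]]] := nerve3P s.
rewrite /cdelta !big_ord_recl big_ord0 addr0.
rewrite (@cat_cochainE _ (nbehead s) y z) /= ?E //.
rewrite (@cat_cochainE _ (nmerge s ord0) (mcomp x y) z) /= ?E //.
rewrite (@cat_cochainE _ (nmerge s (lift ord0 ord0)) x (mcomp y z)) /= ?E //.
rewrite (@cat_cochainE _ (ntake s) x y) /= ?E //.
have p : is_epath (cod x) (nf x ++ nf y ++ nf z).
  by rewrite is_epath_cat nf_path nf_source cxy nf_cat_path.
have Er := sort_cost_catr phi p.
rewrite catA in p Er; have := sort_cost_catl phi0 p; rewrite {}Er.
rewrite !esort_nf_cat // => H.
rewrite !mulrz_sign /=.
by rewrite [X in X - _]addrCA H [X in _ + X - _]addrC addKr subrr.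
Qed.

Definition Zcat_of (phi : Zcub L A 2) : Zcat L A 2.
Proof.
exists (cat_cochain (val phi)); apply/andP; split.
  exact/asboolP/cat_cochain_normalised.
exact/eqP/cdelta_cat_cochain/eqP/(valP phi).
Defined.

Lemma Zcat_of_npair (phi : Zcub L A 2) mu nu (h : dom mu = cod nu) :
  val (Zcat_of phi) (npair h) = sort_cost (val phi) (nf mu ++ nf nu).
Proof. exact: cat_cochainE. Qed.

Lemma Zcat_of_is_zmod_morphism : zmod_morphism Zcat_of.
Proof.
move=> phi psi; apply/val_inj/funext => s; exact: sort_costB.
Qed.

HB.instance Definition _ :=
  GRing.isZmodMorphism.Build _ _ Zcat_of Zcat_of_is_zmod_morphism.

(** The sign is negative because the categorical coboundary of a 1-cochain [H]
is [H mu + H nu - H (mu nu)], whereas sorting costs the increase of the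
total. *)
Lemma Zcat_of_coboundary (phi : Zcub L A 2) :
  is_coboundary (val phi) -> is_ccoboundary (val (Zcat_of phi)).
Proof.
case=> b phib; pose H la : A := \sum_(e <- nf la) ext b (val e).
exists (fun s => - \sum_(la <- val s) H la).
  case=> -[|la [|la' s]] //= p; rewrite orbF => /eqP/nf_deg0 E.
  by rewrite big_seq1 /H E big_nil oppr0.
apply/funext => s; have [mu [nu [E c]]] := nerve2P s.
rewrite /cdelta !big_ord_recl big_ord0 addr0 /= E /= !big_seq1 !mulrz_sign /=.
rewrite (cat_cochainE _ E) phib (sort_cost_delta _ (nf_cat_path c)).
rewrite esort_nf_cat // big_cat /= -/(H mu) -/(H nu) -/(H (mcomp mu nu)).
by rewrite opprK [- H nu + _]addrC opprD addrA addrAC.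
Qed.

(** Defined on chosen representatives; [Hcat_ofE] removes the choice. *)
Definition Hcat_of (x : Hcub L A 2) : Hcat L A 2 :=
  class_cat (Zcat_of (repr x)).

Lemma class_cubB r : {morph @class_cub k L A r : x y / x - y}.
Proof. by move=> x y; rewrite /class_cub Quotient.pi_add Quotient.pi_opp. Qed.

Lemma class_catB r : {morph @class_cat k L A r : x y / x - y}.
Proof. by move=> x y; rewrite /class_cat Quotient.pi_add Quotient.pi_opp. Qed.

Lemma class_cub_repr r (x : Hcub L A r) : class_cub (repr x) = x.
Proof. exact: reprK. Qed.

Lemma Hcat_ofE (phi : Zcub L A 2) :
  Hcat_of (class_cub phi) = class_cat (Zcat_of phi).
Proof.
apply/eqP; rewrite /Hcat_of /class_cat -Quotient.idealrBE -raddfB.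
apply/asboolP/Zcat_of_coboundary/asboolP.
rewrite -[X in is_true X]/(repr (class_cub phi) - phi \in @coboundary k L A 2).
by rewrite Quotient.idealrBE; apply/eqP; apply: reprK.
Qed.

Lemma Hcat_of_is_zmod_morphism : zmod_morphism Hcat_of.
Proof.
move=> x y; rewrite -[x]class_cub_repr -[y]class_cub_repr -class_cubB.
by rewrite !Hcat_ofE raddfB class_catB.
Qed.

HB.instance Definition _ :=
  GRing.isZmodMorphism.Build _ _ Hcat_of Hcat_of_is_zmod_morphism.

End CategoricalCocycle.

Theorem theorem3p16 (k : nat) (L : kgraph k) (A : zmodType) :
  exists c : {additive Zcub L A 2 -> Zcat L A 2},
    [/\ forall (phi : Zcub L A 2) (mu nu : L) (h : dom mu = cod nu),
          val (c phi) (npair h) = shuffle2 (val phi) h,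
        forall (phi : Zcub L A 2) (f g : L) (h : dom f = cod g) (i j : 'I_k),
          deg f = gen i -> deg g = gen j ->
          ((j < i)%N -> exists2 q : cube L 2,
              val q = mcomp f g & val (c phi) (npair h) = val phi q)
          /\ ((i <= j)%N -> val (c phi) (npair h) = 0),
        forall (phi : Zcub L A 2) (mu nu : L) (h : dom mu = cod nu),
          nf_cat h = normal_form (mcomp mu nu) -> val (c phi) (npair h) = 0,
        forall (phi : Zcub L A 2) (la : L),
          val (c phi) (npair (dom_id (cod la))) = 0 /\
          val (c phi) (npair (esym (cod_id (dom la)))) = 0
      & (forall phi : Zcub L A 2,
          is_coboundary (val phi) -> is_ccoboundary (val (c phi))) /\
        exists psi : {additive Hcub L A 2 -> Hcat L A 2},
          forall phi : Zcub L A 2, psi (class_cub phi) = class_cat (c phi)].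
Proof.
exists Zcat_of; split.
- move=> phi mu nu h; rewrite /shuffle2 shuffleE; last exact/eqP/(valP phi).
  exact: Zcat_of_npair.
- move=> phi f g h i j df dg; rewrite Zcat_of_npair.
  have -> : nf f = [:: mk_edge df] by apply: (nf_edge (mk_edge df)).
  have -> : nf g = [:: mk_edge dg] by apply: (nf_edge (mk_edge dg)).
  have cf : colour (mk_edge df) = i by apply: colour_eq.
  have cg : colour (mk_edge dg) = j by apply: colour_eq.
  rewrite /= cf cg !add0r; case: leqP => [|ji]; split=> // _.
  have fg : is_cube 2 (mcomp f g).
    apply: (@edges_square _ _ (mk_edge df) (mk_edge dg)) => //.
    by rewrite cf cg neq_ltn ji orbT.
  exists (exist (fun x => is_true (is_cube 2 x)) _ fg) => //.
  by rewrite addr0 -ext_val.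
- move=> phi mu nu h E; rewrite Zcat_of_npair.
  rewrite -[nf mu ++ nf nu]/(edges (nf_cat h)) E.
  exact/sort_cost_increasing/nf_increasing.
- move=> phi la; split; apply: cat_cochain_normalised;
    by rewrite /= deg_id eqxx ?orbT.
- split; first exact: Zcat_of_coboundary.
  by exists Hcat_of; apply: Hcat_ofE.
Qed.
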